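(* For any integers $m,n\ge 2$, $pd_s(P_m\Box P_n)=3$.
   Context: Graphs are finite, simple, connected; $d_G$ is shortest-path distance, $d_G(x,W)=\min\{d_G(x,w):w\in W\}$. A set $W$ strongly resolves different vertices $x,y\notin W$ if $d_G(x,W)=d_G(x,y)+d_G(y,W)$ or $d_G(y,W)=d_G(y,x)+d_G(x,W)$. A vertex partition $\Pi$ is a strong resolving partition if every two different vertices in the same set of $\Pi$ are strongly resolved by some set of $\Pi$; $pd_s(G)$ is the minimum cardinality of such a partition. $P_m$ is the path on $m$ vertices and $\Box$ denotes the Cartesian product of graphs. *)

(* Defs.v *)
From mathcomp Require Import all_boot.

Set Implicit Arguments.
Unset Strict Implicit.
Unset Printing Implicit Defensive.

Record sgraph := SGraph {
  vertex :> finType;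
  adj : rel vertex;
  adj_sym : symmetric adj;
  adj_irr : irreflexive adj;
  adj_conn : forall x y, connect adj x y }.

Section Distance.
Variable G : sgraph.
Implicit Types (x y : G) (W : {set G}).

Definition walk_of_length x y (n : nat) : bool :=
  [exists p : n.-tuple G, path (@adj G) x p && (last x p == y)].

Lemma walk_exists x y : exists n, walk_of_length x y n.
Proof.
have /connectP[p xp ->] := adj_conn x y.
by exists (size p); apply/existsP; exists (in_tuple p); rewrite xp eqxx.
Qed.

Definition dist x y : nat := ex_minn (walk_exists x y).

Lemma dist_lt_card x y : dist x y < #|G|.
Proof.
rewrite /dist; case: ex_minnP => n _ min_n.
have /connectP[p xp yE] := adj_conn x y; rewrite {}yE in min_n.
case/shortenP: xp min_n => q xq uq _ /(_ (size q)) min_q.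
have /leq_ltn_trans -> // : n <= size q.
  by apply: min_q; apply/existsP; exists (in_tuple q); rewrite xq eqxx.
by have /card_uniqP /= <- := uq; exact: max_card.
Qed.

(* The neutral value #|G| exceeds every distance, so for nonempty W this is
   the true minimum (setdist_min); only nonempty W matter below, since the
   parts of a partition are nonempty. *)
Definition setdist x W : nat := \big[minn/#|G|]_(w in W) dist x w.

Lemma setdist_min x W : W != set0 ->
  (exists2 w, w \in W & setdist x W = dist x w) /\
  {in W, forall w, setdist x W <= dist x w}.
Proof.
move=> /set0Pn[w0 w0W].
have leW : {in W, forall w, setdist x W <= dist x w}.
  move=> w wW; rewrite /setdist -big_filter.
  have: w \in [seq i <- index_enum G | i \in W].
    by rewrite mem_filter wW mem_index_enum.
  elim: [seq i <- _ | _] => //= z s IHs; rewrite inE big_cons geq_min.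
  by case/predU1P=> [-> | /IHs ->]; rewrite ?leqnn ?orbT.
split=> //.
have : setdist x W = #|G| \/ exists2 w, w \in W & setdist x W = dist x w.
  rewrite /setdist; elim/big_ind: _ => [|a b Ha Hb|w wW]; first by left.
    by rewrite /minn; case: ifP.
  by right; exists w.
case=> // E; have := leq_ltn_trans (leW _ w0W) (dist_lt_card x w0).
by rewrite E ltnn.
Qed.

Definition strongly_resolves W x y : bool :=
  [&& x \notin W, y \notin W &
      (setdist x W == dist x y + setdist y W)
      || (setdist y W == dist y x + setdist x W)].

Definition strong_resolving_partition (Pi : {set {set G}}) : bool :=
  partition Pi [set: G] &&
  [forall A in Pi, forall x in A, forall y in A,
     (x != y) ==> [exists W in Pi, strongly_resolves W x y]].

Lemma strong_resolving_partition_exists :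
  exists k, [exists Pi : {set {set G}},
               strong_resolving_partition Pi && (#|Pi| == k)].
Proof.
set Pi := [set [set x] | x : G].
exists #|Pi|; apply/existsP; exists Pi; rewrite eqxx andbT; apply/andP; split.
  apply/and3P; split.
  - apply/eqP/setP=> x; rewrite inE; apply/bigcupP; exists [set x].
      exact: imset_f.
    exact: set11.
  - apply/trivIsetP=> _ _ /imsetP[x _ ->] /imsetP[y _ ->] nxy.
    by rewrite disjoints1 inE; apply: contraNneq nxy => ->.
  - apply/imsetP=> -[x _ /setP/(_ x)]; by rewrite !inE eqxx.
apply/forall_inP=> _ /imsetP[z _ ->].
apply/forall_inP=> x /set1P->; apply/forall_inP=> y /set1P->.
by rewrite eqxx.
Qed.

Definition pds : nat := ex_minn strong_resolving_partition_exists.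

End Distance.

Section PathGraph.
Variable m : nat.

Definition path_adj : rel 'I_m := fun i j => (i.+1 == j :> nat) || (j.+1 == i :> nat).

Lemma path_adj_sym : symmetric path_adj.
Proof. by move=> i j; rewrite /path_adj orbC. Qed.

Lemma path_adj_irr : irreflexive path_adj.
Proof. by move=> i; rewrite /path_adj orbb gtn_eqF. Qed.

Lemma path_adj_conn (i j : 'I_m) : connect path_adj i j.
Proof.
wlog le_ij : i j / i <= j => [hw|].
  case: (leqP i j) => [|/ltnW] /hw //.
  by rewrite (sym_connect_sym path_adj_sym).
case: j le_ij => j; elim: j => [|j IHj] ltj /=.
  by rewrite leqn0 => /eqP i0; apply: eq_connect0; apply: val_inj.
rewrite leq_eqVlt => /orP[/eqP ij|lt_ij].
  by apply: eq_connect0; apply: val_inj.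
apply: connect_trans (IHj (ltnW ltj) lt_ij) (connect1 _).
by rewrite /path_adj /= eqxx.
Qed.

Definition path_graph : sgraph := SGraph path_adj_sym path_adj_irr path_adj_conn.

End PathGraph.

Section CartesianProduct.
Variables G H : sgraph.

Definition cart_adj : rel (G * H) := fun u v =>
  ((u.1 == v.1) && adj u.2 v.2) || ((u.2 == v.2) && adj u.1 v.1).

Lemma cart_adj_sym : symmetric cart_adj.
Proof.
move=> u v; rewrite /cart_adj.
by rewrite [adj u.1 _]adj_sym [adj u.2 _]adj_sym eq_sym [u.2 == _]eq_sym.
Qed.

Lemma cart_adj_irr : irreflexive cart_adj.
Proof. by move=> u; rewrite /cart_adj !adj_irr !andbF. Qed.

Lemma cart_adj_conn u v : connect cart_adj u v.
Proof.
case: u v => [a b] [c d]; apply: (@connect_trans _ _ (c, b)).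
  have /connectP[p ap ->] := adj_conn a c.
  elim: p a ap => [|z p IHp] a //= /andP[az zp].
  apply: connect_trans (connect1 _) (IHp z zp).
  by rewrite /cart_adj /= eqxx az orbT.
have /connectP[p bp ->] := adj_conn b d.
elim: p b bp => [|z p IHp] b //= /andP[bz zp].
apply: connect_trans (connect1 _) (IHp z zp).
by rewrite /cart_adj /= eqxx bz.
Qed.

Definition cart_prod : sgraph := SGraph cart_adj_sym cart_adj_irr cart_adj_conn.

End CartesianProduct.

(* Main.v *)
Require Import Defs.
From mathcomp Require Import all_boot zify.

(** If a strong resolving partition has at most two parts, then two vertices of
    one part that both have neighbours in the other part are at the same
    distance 1 from it, hence are not resolved. So at most one edge joins the
    two parts; in a grid every edge lies on a 4-cycle, which cannot be cut by a
    single edge. Conversely, for two vertices of a grid, one of them lies on a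
    shortest path from the other to the corner (0, 0) or to the corner
    (0, n-1); these two corners as singletons, and everything else, form a
    strong resolving partition. *)

Set Implicit Arguments.
Unset Strict Implicit.
Unset Printing Implicit Defensive.

(** * Distances and strong resolving partitions in an arbitrary graph *)

Section DistanceTheory.
Variable G : sgraph.
Implicit Types (x y z : G) (W S : {set G}) (Pi : {set {set G}}).

Lemma dist_le_path x (p : seq G) :
  path (@adj G) x p -> dist x (last x p) <= size p.
Proof.
move=> xp; rewrite /dist; case: ex_minnP => n _; apply.
by apply/existsP; exists (in_tuple p); rewrite xp eqxx.
Qed.

Lemma geodesic x y :
  exists p, [/\ path (@adj G) x p, last x p = y & size p = dist x y].
Proof.
rewrite /dist; case: ex_minnP => n /existsP[p /andP[xp /eqP lp]] _.
by exists p; rewrite size_tuple.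
Qed.

Lemma distxx x : dist x x = 0.
Proof. by apply/eqP; rewrite -leqn0; exact: (@dist_le_path x [::]). Qed.

Lemma dist_eq0 x y : (dist x y == 0) = (x == y).
Proof.
apply/eqP/eqP => [|->]; last exact: distxx.
by have [[|z p] [_ /= <- <-]] := geodesic x y.
Qed.

Lemma dist_triangle y x z : dist x z <= dist x y + dist y z.
Proof.
have [p [xp <- <-]] := geodesic x y.
have [q [yq <- <-]] := geodesic (last x p) z.
by rewrite -size_cat -last_cat dist_le_path // cat_path xp.
Qed.

Lemma dist_adj x y : adj x y -> dist x y <= 1.
Proof. by move=> xy; apply: (@dist_le_path x [:: y]); rewrite /= xy. Qed.

(** Along each edge of a geodesic [f] drops by at most one. With [f] a formula vanishing at the
    target, this bounds distances from below. *)
Lemma dist_lipschitz (f : G -> nat) :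
  (forall x y, adj x y -> f x <= (f y).+1) ->
  forall x y, f x <= f y + dist x y.
Proof.
move=> lip x y; have [p [xp <- <-]] := geodesic x y.
elim: p x xp => [|z p IHp] x /=; first by rewrite addn0.
by case/andP=> /lip xz /IHp; lia.
Qed.

Lemma setdist1 x w : setdist x [set w] = dist x w.
Proof.
have [|[z /set1P -> //] _] := @setdist_min G x [set w].
by apply/set0Pn; exists w; rewrite set11.
Qed.

Lemma setdist_adj W x y : adj x y -> x \notin W -> y \in W -> setdist x W = 1.
Proof.
move=> xy xW yW; have W0 : W != set0 by apply/set0Pn; exists y.
have [[w wW dw] /(_ y yW) le1] := setdist_min x W0.
have : dist x w != 0 by rewrite dist_eq0; apply: contraNneq xW => ->.
by have := dist_adj xy; lia.
Qed.

Lemma strong_resolving_partitionP Pi :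
  reflect (partition Pi [set: G] /\
           forall x y, pblock Pi x = pblock Pi y -> x != y ->
             exists2 W, W \in Pi & strongly_resolves W x y)
          (strong_resolving_partition Pi).
Proof.
apply: (iffP andP) => -[partPi resPi]; split=> //.
  have /and3P[/eqP covPi trivPi _] := partPi.
  move=> x y pxy nxy; move/forall_inP: resPi.
  have cov z : z \in cover Pi by rewrite covPi inE.
  have xP : x \in pblock Pi x by rewrite mem_pblock.
  have yP : y \in pblock Pi x by rewrite pxy mem_pblock.
  move/(_ _ (pblock_mem (cov x)))/forall_inP/(_ x xP)/forall_inP/(_ y yP).
  by rewrite nxy => /exists_inP.
have /and3P[_ trivPi _] := partPi.
apply/forall_inP => A AP; apply/forall_inP => x xA; apply/forall_inP => y yA.
apply/implyP => nxy; apply/exists_inP; apply: resPi => //.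
by rewrite !(def_pblock trivPi AP).
Qed.

(** Each vertex of [S] becomes a singleton part, and all other vertices form one more part. *)
Lemma pds_le_strong_resolving_set S :
  (forall x y, x \notin S -> y \notin S -> x != y ->
     exists2 w, w \in S & strongly_resolves [set w] x y) ->
  pds G <= #|S|.+1.
Proof.
(* The parts are the fibres of [f]: [None] labels the vertices outside [S], and an empty fibre
   yields no part. *)
move=> resS; pose f x := if x \in S then Some x else None.
pose Pi := preim_partition f [set: G].
pose g o := [set y | o == f y].
have PiE : Pi = [set g (f x) | x : G].
  apply/setP=> A; apply/imsetP/imsetP=> -[x _ ->]; exists x => //;
  by apply/setP=> y; rewrite !inE.
have partPi : partition Pi [set: G] := preim_partitionP f [set: G].
have /and3P[/eqP covPi trivPi _] := partPi.
have cardPi : #|Pi| <= #|S|.+1.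
  apply: leq_trans (subset_leq_card (_ : _ \subset g @: (None |: Some @: S))) _.
    rewrite PiE; apply/subsetP=> _ /imsetP[x _ ->]; apply: imset_f.
    by rewrite /f; case: ifP => xS; rewrite !inE ?imset_f ?orbT.
  apply: leq_trans (leq_imset_card _ _) _; rewrite cardsU1.
  by apply: leq_add (leq_b1 _) (leq_imset_card _ _).
have singlePi w : w \in S -> [set w] \in Pi.
  move=> wS; rewrite PiE; apply/imsetP; exists w => //; apply/setP=> y.
  rewrite !inE /f wS; case: ifP => yS; first by rewrite eq_sym.
  by apply: contraTF wS => /eqP <-; rewrite yS.
rewrite /pds; case: ex_minnP => k _ /(_ #|Pi|) le_k.
apply: leq_trans (le_k _) cardPi; apply/existsP; exists Pi; rewrite eqxx andbT.
apply/strong_resolving_partitionP; split=> // x y pxy nxy.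
have fxy : f x = f y.
  have : y \in pblock Pi x by rewrite pxy mem_pblock covPi.
  rewrite (@def_pblock _ _ (g (f x))) ?inE; first by move/eqP.
  - by [].
  - by rewrite PiE; apply/imsetP; exists x.
  - by [].
(* Distinct vertices with equal labels both have label [None], so both lie outside [S]. *)
move: fxy; rewrite /f; case: ifP => xS; case: ifP => yS //.
  by move=> [] /eqP; rewrite (negPf nxy).
have [w /singlePi ? ?] := resS x y (negbT xS) (negbT yS) nxy.
by exists [set w].
Qed.

(** * Lower bound: partitions with at most two parts *)

Section TwoParts.
Variable Pi : {set {set G}}.
Hypotheses (srpPi : strong_resolving_partition Pi) (Pi_le2 : #|Pi| <= 2).

Let mem_part x : pblock Pi x \in Pi.
Proof.
by have /andP[/and3P[/eqP covPi _ _] _] := srpPi; rewrite pblock_mem ?covPi.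
Qed.

Let in_part x y : (x \in pblock Pi y) = (pblock Pi y == pblock Pi x).
Proof.
have /andP[/and3P[/eqP covPi trivPi _] _] := srpPi.
by rewrite eq_pblock ?covPi.
Qed.

Let two_parts A B C : A \in Pi -> B \in Pi -> C \in Pi -> A != B ->
  C = A \/ C = B.
Proof.
move=> AP BP CP AB; apply/pred2P; apply: contraLR Pi_le2 => nC.
rewrite -ltnNge (_ : 3 = #|[set C; A; B]|); last first.
  by rewrite -setUA cardsU1 cards2 AB !inE nC.
by apply/subset_leq_card/subsetP=> D; rewrite !inE => /orP[/orP[]|] /eqP->.
Qed.

(** Distinct sources in one part would both be at distance 1 from the opposite part, so resolving
    them would force [dist x x'] to be 0. *)
Let cut_edge_source x y x' y' : adj x y -> adj x' y' ->
  pblock Pi x != pblock Pi y -> pblock Pi x' = pblock Pi x ->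
  pblock Pi y' = pblock Pi y -> x = x'.
Proof.
move=> xy xy' npxy pxx pyy; apply/eqP/negPn/negP => nxx.
have /strong_resolving_partitionP[_ /(_ x x' (esym pxx) nxx)] := srpPi.
case=> W WP /and3P[xW _].
(* A resolving part avoids [x], so only the part of [y] is possible. *)
have [WE|WE] := two_parts (mem_part x) (mem_part y) WP npxy.
  by move: xW; rewrite WE in_part eqxx.
have n0 : dist x x' != 0 by rewrite dist_eq0.
have n0' : dist x' x != 0 by rewrite dist_eq0 eq_sym.
rewrite WE (setdist_adj xy) ?(setdist_adj xy') ?in_part ?pxx ?pyy //.
- by lia.
- by rewrite eq_sym.
- by rewrite eq_sym.
Qed.

(** If the edge [x]-[y] were cut, another edge of the 4-cycle would be cut too: [z]-[y] if [z] is on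
    the side of [x], else [w]-[x] or [w]-[z] according to the side of [w]. Equality of sources then
    gives [x = z], [y = w] or [x = w]. *)
Lemma cut_edge_not_on_square x y z w : adj x y -> adj y z -> adj z w ->
  adj w x -> x != z -> y != w -> pblock Pi x = pblock Pi y.
Proof.
move=> xy yz zw wx nxz nyw; apply/eqP/negPn/negP => npxy.
have [yx xw wz] : [/\ adj y x, adj x w & adj w z] by split; rewrite adj_sym.
have npyx : pblock Pi y != pblock Pi x by rewrite eq_sym.
have zy : adj z y by rewrite adj_sym.
have parts t := two_parts (mem_part x) (mem_part y) (mem_part t) npxy.
have [pz|pz] := parts z.
  by rewrite (cut_edge_source xy zy npxy pz erefl) eqxx in nxz.
have [pw|pw] := parts w; last first.
  by rewrite (cut_edge_source yx wx npyx pw erefl) eqxx in nyw.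
by move: wx; rewrite (cut_edge_source xy wz npxy pw pz) adj_irr.
Qed.

End TwoParts.

Lemma pds_ge3 :
  (exists x y, x != y) ->
  (forall x y, adj x y ->
     exists z w, [/\ adj y z, adj z w, adj w x, x != z & y != w]) ->
  3 <= pds G.
Proof.
move=> [a [b nab]] square; rewrite /pds.
case: ex_minnP => k /existsP[Pi /andP[srpPi /eqP <-]] _.
rewrite ltnNge; apply/negP => Pi_le2.
have /strong_resolving_partitionP[partPi resPi] := srpPi.
have /and3P[/eqP covPi trivPi _] := partPi.
(* No edge is cut, so by connectedness there is a single part. *)
have constPi x y : pblock Pi x = pblock Pi y.
  have /connectP[p xp ->] := adj_conn x y.
  elim: p x xp => //= z p IHp x /andP[xz /IHp <-].
  have [t [w [zt tw wx nxt nzw]]] := square x z xz.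
  exact: cut_edge_not_on_square xz zt tw wx nxt nzw.
(* A part resolving [a] and [b] is nonempty and misses [a], hence would be a second part. *)
have [W WP /and3P[aW _ _]] := resPi a b (constPi a b) nab.
have [w wW] : exists w, w \in W.
  by apply/set0Pn; apply: contraTneq WP => ->; have /and3P[] := partPi.
move: aW; rewrite -(def_pblock trivPi WP wW) -(constPi a) mem_pblock.
by rewrite covPi inE.
Qed.

End DistanceTheory.

(** * Distances in paths and Cartesian products *)

Lemma dist_path_graph m (i j : path_graph m) : dist i j = (i - j) + (j - i) :> nat.
Proof.
apply/eqP; rewrite eqn_leq; apply/andP; split; last first.
  have := @dist_lipschitz _ (fun k : path_graph m => (k - j) + (j - k)) _ i j.
  rewrite /= subnn; apply=> k l; rewrite /= /path_adj; lia.
(* With truncated subtraction the sum is |i - j|; the upper bound is by induction on it, moving [i]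
   one step towards [j]. *)
have [d] := ubnP ((i - j) + (j - i)); elim: d i => // d IHd i.
case: (ltngtP i j) => [lt_ij|lt_ji|/val_inj->]; last by rewrite distxx.
- have ltm : i.+1 < m by apply: leq_ltn_trans lt_ij (ltn_ord j).
  have adj_i : @adj (path_graph m) i (Ordinal ltm) by rewrite /= /path_adj eqxx.
  have := IHd (Ordinal ltm); have := dist_triangle (Ordinal ltm : path_graph m) i j.
  by have := dist_adj adj_i; rewrite /=; lia.
- have ltm : i.-1 < m by have := ltn_ord i; lia.
  have adj_i : @adj (path_graph m) i (Ordinal ltm) by rewrite /= /path_adj /=; lia.
  have := IHd (Ordinal ltm); have := dist_triangle (Ordinal ltm : path_graph m) i j.
  by have := dist_adj adj_i; rewrite /=; lia.
Qed.

(** An edge moves a single coordinate, so the sum is 1-Lipschitz, which gives the lower bound. For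
    the upper bound, lifted geodesics of the factors are joined at [(c, b)]. *)
Lemma dist_cart_prod (G H : sgraph) (u v : cart_prod G H) :
  dist u v = dist u.1 v.1 + dist u.2 v.2.
Proof.
apply/eqP; rewrite eqn_leq; apply/andP; split; last first.
  have := @dist_lipschitz _
    (fun t : cart_prod G H => dist t.1 v.1 + dist t.2 v.2) _ u v.
  rewrite /= !distxx; apply=> -[a b] [c d] /= /orP[] /= /andP[/eqP <-].
    by move/dist_adj; have := dist_triangle d b v.2; lia.
  by move/dist_adj; have := dist_triangle c a v.1; lia.
case: u v => [a b] [c d] /=.
apply: leq_trans (dist_triangle ((c, b) : cart_prod G H) _ _) (leq_add _ _).
  have [p [ap <- <-]] := geodesic a c.
  have := @dist_le_path (cart_prod G H) (a, b) [seq (t, b) | t <- p].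
  rewrite size_map (last_map (fun t => (t, b))); apply.
  rewrite path_map; apply: sub_path ap => s t /= st.
  by rewrite /cart_adj /= eqxx st orbT.
have [p [bp <- <-]] := geodesic b d.
have := @dist_le_path (cart_prod G H) (c, b) [seq (c, t) | t <- p].
rewrite size_map (last_map (pair c)); apply.
rewrite path_map; apply: sub_path bp => s t /= st.
by rewrite /cart_adj /= eqxx st.
Qed.

Lemma path_neighbor m (i : path_graph m) : 2 <= m -> exists j, adj i j.
Proof.
move=> hm; have [ltm|gem] := ltnP i.+1 m.
  by exists (Ordinal ltm); rewrite /= /path_adj eqxx.
have ltm : i.-1 < m by have := ltn_ord i; lia.
by exists (Ordinal ltm); rewrite /= /path_adj /=; lia.
Qed.

Lemma adj_neq (G : sgraph) (x y : G) : adj x y -> x != y.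
Proof. by apply: contraTneq => ->; rewrite adj_irr. Qed.

Theorem theorem22 (m n : nat) (hm : 2 <= m) (hn : 2 <= n) :
  pds (cart_prod (path_graph m) (path_graph n)) = 3.
Proof.
apply/eqP; rewrite eqn_leq; apply/andP; split.
  have m_gt0 : 0 < m by lia.
  have n_gt0 : 0 < n by lia.
  have n1_lt : n.-1 < n by lia.
  pose u : cart_prod (path_graph m) (path_graph n) :=
    (Ordinal m_gt0, Ordinal n_gt0).
  pose v : cart_prod (path_graph m) (path_graph n) :=
    (Ordinal m_gt0, Ordinal n1_lt).
  have card2 : #|[set u; v]| <= 2 by rewrite cards2; case: (u != v).
  apply: leq_trans (pds_le_strong_resolving_set (S := [set u; v]) _) _ => //.
  move=> x y; rewrite !inE !negb_or => /andP[xu xv] /andP[yu yv] _.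
  have : strongly_resolves [set u] x y || strongly_resolves [set v] x y.
    rewrite /strongly_resolves !inE xu xv yu yv /= !setdist1 !dist_cart_prod.
    rewrite !dist_path_graph /= {xu xv yu yv u v card2}.
    case: x y => [[a lta] [b ltb]] [[c ltc] [d ltd]] /=.
    rewrite -orbA; apply/or4P.
    (* The vertex with the smaller first coordinate lies between the other one and a corner: (0, 0)
       if its second coordinate is also the smaller, (0, n-1) otherwise. *)
    case: (leqP a c) => ?; case: (leqP b d) => ?;
      [apply: Or42 | apply: Or44 | apply: Or43 | apply: Or41]; lia.
  by case/orP; [exists u | exists v]; rewrite // !inE eqxx ?orbT.
apply: pds_ge3 => [|[a b] [c d] /= /orP[] /= /andP[/eqP <- h]].
- pose a : path_graph m := Ordinal (ltnW hm).
  pose b : path_graph n := Ordinal (ltnW hn).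
  by have [c /adj_neq ac] := path_neighbor a hm; exists (a, b), (c, b);
    rewrite xpair_eqE negb_and ac.
(* For an edge in the second direction, the square is completed by shifting it to a neighbour [c']
   of [a]. *)
- have [c' ac] := path_neighbor a hm; exists (c', d), (c', b).
  have ca : adj c' a by rewrite adj_sym.
  have db : @adj (path_graph n) d b by rewrite adj_sym.
  rewrite /cart_adj /= in ac ca h db *.
  by rewrite !eqxx ac ca db !orbT !xpair_eqE !negb_and (@adj_neq (path_graph m) _ _ ac).
(* For an edge in the first direction, the shift is to a neighbour [d'] of [b]. *)
- have [d' bd] := path_neighbor b hn; exists (c, d'), (a, d').
  have dB : adj d' b by rewrite adj_sym.
  have ca : @adj (path_graph m) c a by rewrite adj_sym.
  rewrite /cart_adj /= in bd dB h ca *.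
  by rewrite !eqxx bd dB ca !orbT !xpair_eqE !negb_and (@adj_neq (path_graph n) _ _ bd) !orbT.
Qed.
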